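(* Let $a,b\in\mathbb{R}$ with $b-a$ a positive integer, and let $\alpha:\mathbb{N}_{a,b}\to\mathbb{R}$ satisfy $0<\alpha(t)\leq 1$ for all $t\in\mathbb{N}_{a,b}$. For all functions $f,g:\mathbb{N}_{a,b}\rightarrow\mathbb{R}$, we have $$\sum_{t=a+1}^{b-1}f(t)\;{}^{AB}_{a}\nabla^{-\alpha(t)}g(t)=\sum_{t=a+1}^{b-1}g(t)\;{}^{*AB}\nabla_{b}^{-\alpha(t)}f(t)$$ and $$\sum_{t=a+1}^{b-1}f(t)\;{}^{*AB}_{a}\nabla^{-\alpha(t)}g(t)=\sum_{t=a+1}^{b-1}g(t)\;{}^{AB}\nabla_{b}^{-\alpha(t)}f(t).$$
   Context: $\mathbb{N}_{a,b}=\{a,a+1,\dots,b\}$. Sums $\sum_{t=p}^{q}$ run over $t=p,p+1,\dots,q$ (empty sums are $0$). $\rho(t)=t-1$ is the backward jump operator. $\Gamma$ is the Gamma function, and the rising function is $t^{\overline{\beta}}=\Gamma(t+\beta)/\Gamma(t)$ for real $\beta$ and $t\in\mathbb{R}\setminus\{\dots,-2,-1,0\}$, with $0^{\overline{\beta}}=0$. $B:[0,1]\to(0,\infty)$ is a normalization function with $B(0)=B(1)=1$. The variable order $AB$ (Atangana--Baleanu) nabla fractional sums are defined, for $t\in\{a+1,\dots,b-1\}$, as follows. Type I left: $${}^{AB}_{a}\nabla^{-\alpha(t)}f(t)=\frac{1-\alpha(t)}{B(\alpha(t))}f(t)+\frac{\alpha(t)}{B(\alpha(t))\Gamma(\alpha(t))}\sum_{s=a+1}^t(t-\rho(s))^{\overline{\alpha(t)-1}}f(s).$$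 Type II left: $${}^{*AB}_{a}\nabla^{-\alpha(t)}f(t)=\frac{1-\alpha(t)}{B(\alpha(t))}f(t)+\sum_{s=a+1}^t\frac{\alpha(s)}{B(\alpha(s))\Gamma(\alpha(s))}(t-\rho(s))^{\overline{\alpha(s)-1}}f(s).$$ Type I right: $${}^{AB}\nabla_{b}^{-\alpha(t)}f(t)=\frac{1-\alpha(t)}{B(\alpha(t))}f(t)+\frac{\alpha(t)}{B(\alpha(t))\Gamma(\alpha(t))}\sum_{s=t}^{b-1}(s-\rho(t))^{\overline{\alpha(t)-1}}f(s).$$ Type II right: $${}^{*AB}\nabla_{b}^{-\alpha(t)}f(t)=\frac{1-\alpha(t)}{B(\alpha(t))}f(t)+\sum_{s=t}^{b-1}\frac{\alpha(s)}{B(\alpha(s))\Gamma(\alpha(s))}(s-\rho(t))^{\overline{\alpha(s)-1}}f(s).$$ *)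

(* Defs.v *)
From mathcomp Require Import all_boot all_order all_algebra.
From mathcomp Require Import all_classical all_reals all_analysis.
Set Implicit Arguments.
Unset Strict Implicit.
Unset Printing Implicit Defensive.
Import Order.TTheory GRing.Theory Num.Theory.
Local Open Scope classical_set_scope.
Local Open Scope ring_scope.

(* A sum over t = p, p+1, ..., q is the finitely supported sum
   \sum_(t \in Nset p q); Nset p q is empty when q < p.
   Functions on Nset a b are represented by total functions R -> R, of which
   only the values on Nset a b matter. *)
Definition Nset (R : realType) (a b : R) : set R :=
  [set t | t - a \is a Num.nat /\ t <= b].

Lemma Nset_finite (R : realType) (a b : R) : finite_set (Nset a b).
Proof.
apply: (@sub_finite_set _ _ ((fun k : nat => a + k%:R) @` `I_(Num.truncn (b - a)).+1)).
  move=> t [/natrP[k tk] tb]; exists k; last by rewrite -tk addrCA subrr addr0.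
  rewrite /= -(ltr_nat R) -tk; apply: (@le_lt_trans _ _ (b - a)).
    by rewrite lerD2r.
  exact: truncnS_gt.
exact/finite_image/finite_II.
Qed.

Definition rho (R : realType) (t : R) : R := t - 1.

Definition Gamma_integral (R : realType) (x : R) : R :=
  \int[lebesgue_measure]_(u in `]0, +oo[) (u `^ (x - 1) * expR (- u)).

(* Number of applications of Gamma(x + 1) = x Gamma(x) needed to move x into
   the half-line where the integral converges. *)
Definition Gamma_shift (R : realType) (x : R) : nat :=
  if 0 < x then 0%N else (Num.truncn (- x)).+1.

(* Since division by 0 yields 0, this takes the junk value 0 at the poles
   0, -1, -2, ... *)
Definition Gamma (R : realType) (x : R) : R :=
  Gamma_integral (x + (Gamma_shift x)%:R)
    / \prod_(0 <= k < Gamma_shift x) (x + k%:R).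

(* Meaningful for t outside {..., -2, -1}. *)
Definition rising (R : realType) (t beta : R) : R :=
  if t == 0 then 0 else Gamma (t + beta) / Gamma t.

Definition normalization_function (R : realType) (B : R -> R) : Prop :=
  [/\ forall x, 0 <= x <= 1 -> 0 < B x, B 0 = 1 & B 1 = 1].

Definition AB_left_sum1 (R : realType) (B : R -> R) (a : R) (alpha f : R -> R)
    (t : R) : R :=
  (1 - alpha t) / B (alpha t) * f t
  + alpha t / (B (alpha t) * Gamma (alpha t))
    * \sum_(s \in Nset (a + 1) t) (rising (t - rho s) (alpha t - 1) * f s).

Definition AB_left_sum2 (R : realType) (B : R -> R) (a : R) (alpha f : R -> R)
    (t : R) : R :=
  (1 - alpha t) / B (alpha t) * f t
  + \sum_(s \in Nset (a + 1) t)
      (alpha s / (B (alpha s) * Gamma (alpha s))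
       * rising (t - rho s) (alpha s - 1) * f s).

Definition AB_right_sum1 (R : realType) (B : R -> R) (b : R) (alpha f : R -> R)
    (t : R) : R :=
  (1 - alpha t) / B (alpha t) * f t
  + alpha t / (B (alpha t) * Gamma (alpha t))
    * \sum_(s \in Nset t (b - 1)) (rising (s - rho t) (alpha t - 1) * f s).

Definition AB_right_sum2 (R : realType) (B : R -> R) (b : R) (alpha f : R -> R)
    (t : R) : R :=
  (1 - alpha t) / B (alpha t) * f t
  + \sum_(s \in Nset t (b - 1))
      (alpha s / (B (alpha s) * Gamma (alpha s))
       * rising (s - rho t) (alpha s - 1) * f s).

(* Main.v *)
(* Both identities are discrete Fubini over the triangle s <= t. The left sums
   apply a lower triangular kernel K t s and the right sums its transpose; type
   I and type II put the order at t and at s respectively, so transposing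
   exchanges the types. *)
Require Import Defs.
From mathcomp Require Import all_boot all_order all_algebra.
From mathcomp Require Import all_classical all_reals all_analysis.
From mathcomp Require Import ring.
Import Order.TTheory GRing.Theory Num.Theory.
Local Open Scope classical_set_scope.
Local Open Scope ring_scope.

(** Points of [Nset p q] differ by integers, so on it [s <= t] amounts to [t - s] being natural.
    This form of the condition is chosen because it also cuts out the upper ranges in
    [Nset_upperE]. *)
Lemma Nset_lowerE (R : realType) (p q t : R) : Nset p q t ->
  Nset p t = Nset p q `&` [set s | t - s \is a Num.nat].
Proof.
move=> [pt tq]; apply/seteqP; split=> s /=.
  move=> [ps st]; split; first by split=> //; exact: le_trans tq.
  (* Naturals are not closed under subtraction: integrality comes from the two offsets from [p], the
     sign from [s <= t]. *)
  rewrite natrEint subr_ge0 st andbT.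
  have -> : t - s = (t - p) - (s - p) by ring.
  by rewrite rpredB// intr_nat.
by move=> [[ps _] /natr_ge0]; rewrite subr_ge0.
Qed.

Lemma Nset_upperE (R : realType) (p q s : R) : Nset p q s ->
  Nset s q = Nset p q `&` [set t | t - s \is a Num.nat].
Proof.
move=> [ps sq]; apply/seteqP; split=> t /= [].
  move=> st tq; do 2!split=> //.
  have -> : t - p = (t - s) + (s - p) by ring.
  by rewrite rpredD.
by move=> [_ tq] st.
Qed.

(** Extending [F] by zero off the triangle makes both inner ranges independent of the outer
    variable. *)
Lemma exchange_Nset (R : realType) (p q : R) (F : R -> R -> R) :
  \sum_(t \in Nset p q) \sum_(s \in Nset p t) F t s =
  \sum_(s \in Nset p q) \sum_(t \in Nset s q) F t s.
Proof.
transitivity (\sum_(t \in Nset p q) \sum_(s \in Nset p q)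
    if s \in [set s | t - s \is a Num.nat] then F t s else 0).
  by apply: eq_fsbigr => t /set_mem/Nset_lowerE ->; rewrite fsbig_mkcondr.
rewrite exchange_fsbig; [|exact: Nset_finite..].
apply: eq_fsbigr => s /set_mem/Nset_upperE ->; rewrite [RHS]fsbig_mkcondr.
(* One indicator tests [s], the other [t]; both unfold to the same condition on [t - s]. *)
by apply: eq_fsbigr => t _; congr (if _ then _ else _); rewrite !mem_setE.
Qed.

(** The weight [c] is kept apart from [K]: its diagonal term is symmetric in [f] and [g], so only
    the [K] part needs the exchange. *)
Lemma triangular_sum_duality (R : realType) (p q : R) (c : R -> R)
    (K : R -> R -> R) (f g : R -> R) :
  \sum_(t \in Nset p q)
    f t * (c t * g t + \sum_(s \in Nset p t) K t s * g s) =
  \sum_(t \in Nset p q)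
    g t * (c t * f t + \sum_(s \in Nset t q) K s t * f s).
Proof.
under eq_fsbigr do rewrite mulrDr mulr_fsumr.
under [RHS]eq_fsbigr do rewrite mulrDr mulr_fsumr.
rewrite [LHS]fsbig_split; last exact: Nset_finite.
rewrite [RHS]fsbig_split; last exact: Nset_finite.
congr (_ + _); first by apply: eq_fsbigr => t _; ring.
by rewrite exchange_Nset; do 2!apply: eq_fsbigr => ? _; ring.
Qed.

Theorem theorem1 (R : realType) (B : R -> R) (hB : normalization_function B)
    (a b : R) (hab : b - a \is a Num.nat) (hab0 : 0 < b - a)
    (alpha : R -> R)
    (halpha : forall t, Nset a b t -> 0 < alpha t <= 1)
    (f g : R -> R) :
  \sum_(t \in Nset (a + 1) (b - 1)) (f t * AB_left_sum1 B a alpha g t) =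
  \sum_(t \in Nset (a + 1) (b - 1)) (g t * AB_right_sum2 B b alpha f t)
  /\
  \sum_(t \in Nset (a + 1) (b - 1)) (f t * AB_left_sum2 B a alpha g t) =
  \sum_(t \in Nset (a + 1) (b - 1)) (g t * AB_right_sum1 B b alpha f t).
Proof.
pose c t := (1 - alpha t) / B (alpha t).
pose d t := alpha t / (B (alpha t) * Gamma (alpha t)).
split.
- apply: etrans (triangular_sum_duality R _ _ c
    (fun t s => d t * rising (t - rho s) (alpha t - 1)) f g).
  (* The type II side matches the duality by conversion; on the type I side the factor [d t] must
     first move inside the sum. *)
  apply: eq_fsbigr => t _; rewrite /AB_left_sum1 mulr_fsumr.
  by under eq_fsbigr do rewrite mulrA.
- apply: etrans (triangular_sum_duality R _ _ c
    (fun t s => d s * rising (t - rho s) (alpha s - 1)) f g) _.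
  apply: eq_fsbigr => t _; rewrite /AB_right_sum1 mulr_fsumr.
  by under [in RHS]eq_fsbigr do rewrite mulrA.
Qed.
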